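(* The identity map on $\mathbb{O}_{E_8}$ is an isometry among the octonionic, para-octonionic and Okubo integral systems $(\mathbb{O}_{E_8},\cdot,n)$, $(\mathbb{O}_{E_8},\bullet,n)$ and $(\mathbb{O}_{E_8},*,n)$. In particular, all three have the same Gram matrix, the same $240$ norm-one vectors and the same Gosset polytope $4_{21}$ (whose vertices are these $240$ vectors). The three systems are pairwise non-isomorphic as algebras.
   Context: Octonions. $\mathbb{O}$ is the real division algebra of octonions with unit $1$ and basis $1,\mathrm{i},\mathrm{j},\mathrm{k},\mathrm{l},\mathrm{il},\mathrm{jl},\mathrm{kl}$; each imaginary basis unit squares to $-1$, distinct imaginary basis units anticommute, and the remaining products are given by the oriented triples $(\mathrm{i},\mathrm{j},\mathrm{k})$, $(\mathrm{i},\mathrm{l},\mathrm{il})$, $(\mathrm{j},\mathrm{l},\mathrm{jl})$, $(\mathrm{k},\mathrm{l},\mathrm{kl})$, $(\mathrm{jl},\mathrm{i},\mathrm{kl})$, $(\mathrm{kl},\mathrm{j},\mathrm{il})$, $(\mathrm{il},\mathrm{k},\mathrm{jl})$, where $(x,y,z)$ means $xy=z$, $yz=x$, $zx=y$. $\bar x$ is octonionic conjugation, $n(x)=x\bar x$ is the composition norm, and $\langle x,y\rangle=x\bar y+y\bar x=2\operatorname{Re}(x\bar y)$, so $\langle x,x\rangle=2n(x)$. Lattice. $\mathbb{O}_{E_8}$ is the $\mathbb{Z}$-span of $1,\mathrm{i},\mathrm{j},\mathrm{k},\mathrm{h},\mathrm{i}\mathrm{h},\mathrm{j}\mathrm{h},\mathrm{k}\mathrm{h}$,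 where $\mathrm{h}=\tfrac12(\mathrm{i}+\mathrm{j}+\mathrm{k}+\mathrm{l})$ (the Coxeter--Dickson octonions). It is closed under conjugation and octonionic multiplication; with $\langle\cdot,\cdot\rangle$ it is an $E_8$ lattice. Products. Para-octonionic product: $x\bullet y=\bar x\cdot\bar y$. Okubo product: $x*y=\tau(\bar x)\cdot\tau^2(\bar y)$, where, writing $(e_1,\dots,e_7)=(\mathrm{i},\mathrm{j},\mathrm{l},\mathrm{k},\mathrm{kl},\mathrm{jl},\mathrm{il})$, $\tau$ is the $\mathbb{R}$-linear map with $\tau(1)=1$, $\tau(e_3)=e_3$, $\tau(e_1)=e_2$, $\tau(e_2)=-e_4$, $\tau(e_4)=-e_1$, $\tau(e_5)=-e_7$, $\tau(e_7)=e_6$, $\tau(e_6)=-e_5$. The map $\tau$ is an octonion automorphism of order three preserving $\mathbb{O}_{E_8}$. Each of the three products is multiplicative for $n$. Integral system. Given an eight-dimensional real composition algebra $(A,\circ,n)$ and a nonzero idempotent $e\in A$, a $\mathbb{Z}$-integral system relative to $e$ is a free $\mathbb{Z}$-module $L\subset A$ of rank eight with $e\in L$, $L\circ L\subseteq L$, $n(L)\subseteq\mathbb{Z}$ and $\langle L,e\rangle\subseteq\mathbb{Z}$. Here $L=\mathbb{O}_{E_8}$ and $e=1$ for all three products. The Gosset polytope $4_{21}$ of the lattice is the convex hull of its $240$ norm-one vectors (the roots of $E_8$). *)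

(* Defs.v *)
From HB Require Import structures.
From mathcomp Require Import all_boot all_order all_algebra.
From mathcomp Require Import boolp classical_sets functions cardinality reals.
From mathcomp Require Import convex.
From mathcomp Require Import ring.

Set Implicit Arguments.
Unset Strict Implicit.
Unset Printing Implicit Defensive.

Import Order.TTheory GRing.Theory Num.Theory.

Local Open Scope classical_set_scope.
Local Open Scope ring_scope.

Section CompositionAlgebras.
Variables (R : realType) (A : vectType R).

(* For the octonion norm this is x * conj y + y * conj x, see [oct_polarE]. *)
Definition polar (n : A -> R) (x y : A) : R := n (x + y) - n x - n y.

Definition composition_algebra (mul : A -> A -> A) (n : A -> R) : Prop :=
  [/\ (forall x, linear (mul x)) /\ (forall y, linear (mul^~ y)),
      forall a x, n (a *: x) = a ^+ 2 * n x,
      forall x, scalar (polar n x),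
      forall x, (forall y, polar n x y = 0) -> x = 0
    & forall x y, n (mul x y) = n x * n y].

Definition Zcomb m (b : 'I_m -> A) (c : {ffun 'I_m -> int}) : A :=
  \sum_(i < m) b i *~ c i.

Definition Zspan m (b : 'I_m -> A) : set A := range (Zcomb b).

Definition Zbasis m (b : 'I_m -> A) (L : set A) : Prop :=
  Zspan b = L /\ injective (Zcomb b).

(* A triple (L, o, n); [integral_system] below imposes the axioms. *)
Record system := System {
  lattice : set A;
  product : A -> A -> A;
  qnorm : A -> R
}.

Definition integral_system (S : system) (e : A) : Prop :=
  [/\ composition_algebra (product S) (qnorm S) /\ \dim {: A} = 8%N,
      e != 0 /\ product S e e = e,
      (exists b : 'I_8 -> A, Zbasis b (lattice S)),
      lattice S e /\
        (forall x y, lattice S x -> lattice S y -> lattice S (product S x y))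
    & forall x, lattice S x ->
        (qnorm S x \is a Num.int) /\ (polar (qnorm S) x e \is a Num.int)].

Definition gram (S : system) m (b : 'I_m -> A) : 'M[R]_m :=
  \matrix_(i, j) polar (qnorm S) (b i) (b j).

Definition norm_one_vectors (S : system) : set A :=
  [set x | lattice S x /\ qnorm S x = 1].

Definition convex_hull (X : set A) : set A := smallest (@convex_set R A) X.

Definition gosset_polytope (S : system) : set A :=
  convex_hull (norm_one_vectors S).

(* The vertices of a polytope are its extreme points. *)
Definition vertices (P : set A) : set A :=
  [set x | P x /\ forall y z (t : R), P y -> P z -> 0 < t < 1 ->
                    x = t *: y + (1 - t) *: z -> y = x /\ z = x].

End CompositionAlgebras.

Section Morphisms.
Variables (R : realType) (A B : vectType R).

(* As the lattices are subgroups, additivity is Z-linearity. *)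
Definition Zlinear_bijection (S : system A) (T : system B) (f : A -> B) : Prop :=
  set_bij (lattice S) (lattice T) f /\
  forall x y, lattice S x -> lattice S y -> f (x + y) = f x + f y.

Definition lattice_isometry (S : system A) (T : system B) (f : A -> B) : Prop :=
  Zlinear_bijection S T f /\
  forall x, lattice S x -> qnorm T (f x) = qnorm S x.

Definition algebra_isomorphic (S : system A) (T : system B) : Prop :=
  exists f : A -> B, Zlinear_bijection S T f /\
    forall x y, lattice S x -> lattice S y ->
      f (product S x y) = product T (f x) (f y).

End Morphisms.

Section Octonions.
Variable R : realType.

(* Coordinates are taken in the basis
     0   1   2   3   4   5   6   7
     1   i   j   k   l   il  jl  kl   *)
Local Notation O := 'rV[R]_8.

Definition oct_unit (a : nat) : O := \row_(c < 8) ((c : nat) == a)%:R.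

Definition oriented_triples : seq (nat * nat * nat) :=
  [:: (1, 2, 3); (1, 4, 5); (2, 4, 6); (3, 4, 7);
      (6, 1, 7); (7, 2, 5); (5, 3, 6)]%N.

Definition cyclic_triples : seq (nat * nat * nat) :=
  flatten [seq [:: (t.1.1, t.1.2, t.2); (t.1.2, t.2, t.1.1); (t.2, t.1.1, t.1.2)]
          | t <- oriented_triples].

(* The product of basis units number a and b: a cyclic triple (a, b, c) gives
   ab = c and ba = - c. *)
Definition unit_mul (a b : nat) : O :=
  if a == 0%N then oct_unit b
  else if b == 0%N then oct_unit a
  else if a == b then - oct_unit 0
  else if [seq t <- cyclic_triples | t.1 == (a, b)] is t :: _ then oct_unit t.2
  else if [seq t <- cyclic_triples | t.1 == (b, a)] is t :: _ then - oct_unit t.2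
  else 0.

Definition oct_mul (x y : O) : O :=
  \sum_(a < 8) \sum_(b < 8) (x 0 a * y 0 b) *: unit_mul a b.

Definition oct_conj (x : O) : O :=
  \row_(c < 8) (if (c : nat) == 0%N then x 0 c else - x 0 c).

(* x * conj x is a real multiple of 1, see [oct_normE]; the norm is that real. *)
Definition oct_norm (x : O) : R := oct_mul x (oct_conj x) 0 0.

(* tau on the basis units: 1 -> 1, i -> j, j -> -k, k -> -i, l -> l,
   il -> jl, jl -> -kl, kl -> -il. *)
Definition tau_unit (a : nat) : O :=
  nth 0 [:: oct_unit 0; oct_unit 2; - oct_unit 3; - oct_unit 1; oct_unit 4;
            oct_unit 6; - oct_unit 7; - oct_unit 5] a.

Definition oct_tau (x : O) : O := \sum_(a < 8) x 0 a *: tau_unit a.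

Definition para_mul (x y : O) : O := oct_mul (oct_conj x) (oct_conj y).

Definition okubo_mul (x y : O) : O :=
  oct_mul (oct_tau (oct_conj x)) (oct_tau (oct_tau (oct_conj y))).

Definition oct_h : O :=
  2^-1 *: (oct_unit 1 + oct_unit 2 + oct_unit 3 + oct_unit 4).

Definition coxeter_dickson_basis (a : 'I_8) : O :=
  nth 0 [:: oct_unit 0; oct_unit 1; oct_unit 2; oct_unit 3; oct_h;
            oct_mul (oct_unit 1) oct_h; oct_mul (oct_unit 2) oct_h;
            oct_mul (oct_unit 3) oct_h] a.

Definition coxeter_dickson : set O := Zspan coxeter_dickson_basis.

(* The c-th coordinate of [unit_mul a b], as an integer. *)
Definition unit_coef (a b c : nat) : int :=
  if a == 0%N then (c == b)%N%:Z
  else if b == 0%N then (c == a)%N%:Z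
  else if a == b then - (c == 0)%N%:Z
  else if [seq t <- cyclic_triples | t.1 == (a, b)] is t :: _ then (c == t.2)%N%:Z
  else if [seq t <- cyclic_triples | t.1 == (b, a)] is t :: _ then - (c == t.2)%N%:Z
  else 0.

Lemma unit_mulE a b (c : 'I_8) : unit_mul a b 0 c = (unit_coef a b c)%:~R.
Proof.
rewrite /unit_mul /unit_coef; do 3 (case: ifP => _; first by rewrite !mxE ?rmorphN).
case: filter => [|t _]; last by rewrite mxE.
by case: filter => [|t _]; rewrite !mxE ?rmorphN.
Qed.

Lemma sum88 (F : nat -> nat -> R) : \sum_(a < 8) \sum_(b < 8) F a b
  = foldr (fun a s => foldr (fun b s => F a b + s) 0 (iota 0 8) + s) 0 (iota 0 8).
Proof.
have sum8 (G : nat -> R) : \sum_(a < 8) G a = foldr (fun a s => G a + s) 0 (iota 0 8).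
  by rewrite -(big_mkord xpredT G) unlock.
by rewrite (sum8 (fun a => \sum_(b < 8) F a b)) /= !(sum8 (F _)).
Qed.

Lemma oct_mulE (x y : O) (c : 'I_8) :
  oct_mul x y 0 c = \sum_(a < 8) \sum_(b < 8)
    x 0 (inord a) * y 0 (inord b) * (unit_coef a b c)%:~R.
Proof.
rewrite /oct_mul summxE; apply: eq_bigr => a _.
by rewrite summxE; apply: eq_bigr => b _; rewrite mxE !inord_val unit_mulE.
Qed.

Lemma oct_normE (x : O) : oct_mul x (oct_conj x) = oct_norm x *: oct_unit 0.
Proof.
pose X a : R := x 0 (inord a).
pose S c := \sum_(a < 8) \sum_(b < 8)
  X a * (if (b : nat) == 0%N then X b else - X b) * (unit_coef a b c)%:~R.
have E c : oct_mul x (oct_conj x) 0 c = S c.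
  rewrite oct_mulE; apply: eq_bigr => a _; apply: eq_bigr => b _.
  by congr (_ * _ * _); rewrite mxE /X !inord_val.
apply/rowP => c; rewrite /oct_norm [RHS]mxE !E mxE.
clear E; clearbody X; case: c => c /= lc; rewrite {}/S.
rewrite !(sum88 (fun a b =>
  X a * (if b == 0%N then X b else - X b) * (unit_coef a b _)%:~R)).
do 8 (case: c lc => [_|c lc]; first by rewrite /= /unit_coef /=; ring).
by [].
Qed.

Lemma oct_polarE (x y : O) :
  oct_mul x (oct_conj y) + oct_mul y (oct_conj x)
  = polar oct_norm x y *: oct_unit 0.
Proof.
have mulDl u v w : oct_mul (u + v) w = oct_mul u w + oct_mul v w.
  rewrite -big_split; apply: eq_bigr => a _; rewrite -big_split.
  by apply: eq_bigr => b _; rewrite !mxE mulrDl scalerDl.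
have mulDr u v w : oct_mul w (u + v) = oct_mul w u + oct_mul w v.
  rewrite -big_split; apply: eq_bigr => a _; rewrite -big_split.
  by apply: eq_bigr => b _; rewrite !mxE mulrDr scalerDl.
have conjD : oct_conj (x + y) = oct_conj x + oct_conj y.
  by apply/rowP => c; rewrite !mxE; case: ifP => // _; rewrite opprD.
rewrite /polar !scalerBl -!oct_normE conjD !mulDl !mulDr.
by apply/rowP => c; rewrite !mxE; ring.
Qed.

End Octonions.

Inductive octonion_product := Octonionic | ParaOctonionic | Okubo.

Definition product_of (R : realType) (p : octonion_product) :
    'rV[R]_8 -> 'rV[R]_8 -> 'rV[R]_8 :=
  match p with
  | Octonionic => @oct_mul R
  | ParaOctonionic => @para_mul R
  | Okubo => @okubo_mul R
  end.

Definition E8_system (R : realType) (p : octonion_product) :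
    system 'rV[R]_8 :=
  System (@coxeter_dickson R) (product_of p) (@oct_norm R).

(* Main.v *)
Require Import Defs.
From mathcomp Require Import all_boot all_order all_algebra.
From mathcomp Require Import boolp classical_sets functions cardinality reals.
From mathcomp Require Import convex interval_inference.
From mathcomp Require Import finmap zify ring lra.

(** The three systems share their lattice and their norm by definition, so the
    identity is an isometry, and Gram matrices, norm-one vectors and Gosset
    polytopes coincide. What needs proof is that they are integral systems, the
    count of 240, the description of the vertices, and non-isomorphism.

    Integral systems. In coordinates the norm is a sum of eight squares, and
    conjugation and tau are signed permutations of the coordinates. Hence the
    multiplicativity of all three products reduces to the eight-square identity
    ([oct_norm_mul]). An element of the lattice is one half of an integer word
    of length eight subject to four parity conditions ([coxeter_dicksonP]): twice
    the lattice is the preimage in Z^8 of the extended Hamming code. Stability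
    under conjugation and tau is read off the parity conditions; stability under
    the octonionic product is bilinear, hence a finite check on the basis
    ([coxeter_dickson_mul]).

    The 240 vectors. A vector of norm one is half of a parity word of squared
    length 4, and the finitely many integer words of squared length 4 can be
    listed ([card_norm_one_vectors]).

    Vertices. An extreme point of a convex hull belongs to the generating set,
    since removing any other extreme point leaves a smaller convex set
    ([vertices_hull_sub]). Conversely a Euclidean ball is strictly convex, so
    points of the sphere are extreme in the hull of any subset of the sphere
    ([sphere_sub_vertices]).

    Non-isomorphism. Two properties are invariant under isomorphism and tell the
    systems apart: having a left unit, and having a nonzero element that commutes
    with everything. The element 1 has both properties for the octonionic
    product. For the para-octonionic product it still commutes with everything,
    but there is no left unit, because multiplication by 1 is conjugation. The
    Okubo product twists its two arguments by different powers of tau, and then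
    commuting with i and l already forces an element to vanish
    ([okubo_no_nonzero_center]). *)

Set Implicit Arguments.
Unset Strict Implicit.
Unset Printing Implicit Defensive.

Import Order.TTheory GRing.Theory Num.Theory.

Local Open Scope classical_set_scope.
Local Open Scope card_scope.
Local Open Scope ring_scope.

(** * Octonions in coordinates *)

Section SeqOctonions.
Variable T : comNzRingType.
Implicit Types s t : seq T.

(** The coordinate formulas make sense over any ring: over the reals they
    compute in the octonions, over the integers they allow finite checks by
    evaluation. *)
Definition mul_seq s t : seq T := [::
  s`_0 * t`_0 - s`_1 * t`_1 - s`_2 * t`_2 - s`_3 * t`_3
    - s`_4 * t`_4 - s`_5 * t`_5 - s`_6 * t`_6 - s`_7 * t`_7;
  s`_0 * t`_1 + s`_1 * t`_0 + s`_2 * t`_3 - s`_3 * t`_2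
    + s`_4 * t`_5 - s`_5 * t`_4 - s`_6 * t`_7 + s`_7 * t`_6;
  s`_0 * t`_2 - s`_1 * t`_3 + s`_2 * t`_0 + s`_3 * t`_1
    + s`_4 * t`_6 + s`_5 * t`_7 - s`_6 * t`_4 - s`_7 * t`_5;
  s`_0 * t`_3 + s`_1 * t`_2 - s`_2 * t`_1 + s`_3 * t`_0
    + s`_4 * t`_7 - s`_5 * t`_6 + s`_6 * t`_5 - s`_7 * t`_4;
  s`_0 * t`_4 - s`_1 * t`_5 - s`_2 * t`_6 - s`_3 * t`_7
    + s`_4 * t`_0 + s`_5 * t`_1 + s`_6 * t`_2 + s`_7 * t`_3;
  s`_0 * t`_5 + s`_1 * t`_4 - s`_2 * t`_7 + s`_3 * t`_6
    - s`_4 * t`_1 + s`_5 * t`_0 - s`_6 * t`_3 + s`_7 * t`_2;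
  s`_0 * t`_6 + s`_1 * t`_7 + s`_2 * t`_4 - s`_3 * t`_5
    - s`_4 * t`_2 + s`_5 * t`_3 + s`_6 * t`_0 - s`_7 * t`_1;
  s`_0 * t`_7 - s`_1 * t`_6 + s`_2 * t`_5 + s`_3 * t`_4
    - s`_4 * t`_3 - s`_5 * t`_2 + s`_6 * t`_1 + s`_7 * t`_0].

Definition conj_seq s : seq T :=
  [:: s`_0; - s`_1; - s`_2; - s`_3; - s`_4; - s`_5; - s`_6; - s`_7].

Definition tau_seq s : seq T :=
  [:: s`_0; - s`_3; s`_1; - s`_2; s`_4; - s`_7; s`_5; - s`_6].

End SeqOctonions.

Lemma nth_map_rmorph (S T : comNzRingType) (f : {rmorphism S -> T}) (u : seq S) i :
  (map f u)`_i = f u`_i.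
Proof. by elim: u i => [|a u IH] [|i] //=; rewrite rmorph0. Qed.

Lemma map_mul_seq (S T : comNzRingType) (f : {rmorphism S -> T}) (s t : seq S) :
  map f (mul_seq s t) = mul_seq (map f s) (map f t).
Proof.
by rewrite /mul_seq !nth_map_rmorph /= !(rmorphD, rmorphN, rmorphM).
Qed.

Section Coordinates.
Variable R : realType.
Local Notation O := 'rV[R]_8.
Implicit Types s t : seq R.

Definition octv s : O := \row_i s`_i.

Lemma octv_surj (x : O) : exists s, x = octv s.
Proof.
exists [seq x 0 i | i <- enum 'I_8]; apply/rowP => i.
by rewrite mxE (nth_map i) ?size_enum_ord ?nth_ord_enum.
Qed.

Lemma octvP s t :
  (forall i, (i < 8)%N -> s`_i = t`_i) -> octv s = octv t.
Proof. by move=> E; apply/rowP => i; rewrite !mxE E. Qed.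

Lemma octv_inj s t i : (i < 8)%N -> octv s = octv t -> s`_i = t`_i.
Proof. by move=> i8 /rowP/(_ (Ordinal i8)); rewrite !mxE. Qed.

Lemma octvZ a s : a *: octv s = octv (map ( *%R a) s).
Proof.
apply/rowP => i; rewrite !mxE.
by elim: s (val i) => [|b s IH] [|j] //=; rewrite mulr0.
Qed.

Lemma oct_unitE a : oct_unit R a = octv (mkseq (fun i => (i == a)%:R) 8).
Proof. by apply/rowP => i; rewrite !mxE nth_mkseq. Qed.

Lemma oct_mul_octv s t : oct_mul (octv s) (octv t) = octv (mul_seq s t).
Proof.
apply/rowP => c; rewrite oct_mulE mxE.
under eq_bigr do under eq_bigr do rewrite !mxE !inordK //.
rewrite (sum88 (fun a b => s`_a * t`_b * (unit_coef a b c)%:~R)).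
move: (nat_of_ord c) (ltn_ord c) => {}c lc.
do 8 (case: c lc => [_|c lc]; first by rewrite /= /unit_coef /=; ring).
by [].
Qed.

Lemma oct_conj_octv s : oct_conj (octv s) = octv (conj_seq s).
Proof. by apply/rowP => -[c lc]; rewrite !mxE; do 8 case: c lc => // c lc. Qed.

Lemma oct_tau_octv s : oct_tau (octv s) = octv (tau_seq s).
Proof.
apply/rowP => c; rewrite /oct_tau summxE !big_ord_recl big_ord0 !mxE /=.
move: (nat_of_ord c) (ltn_ord c) => {}c lc.
do 8 (case: c lc => [_|c lc]; first by rewrite /= ?mxE /=; ring).
by [].
Qed.

Lemma oct_norm_octv s : oct_norm (octv s) = \sum_(i < 8) s`_i ^+ 2.
Proof.
rewrite /oct_norm oct_conj_octv oct_mul_octv mxE /=.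
by rewrite !big_ord_recl big_ord0 /=; ring.
Qed.

(** Degen's eight-square identity. *)
Lemma oct_norm_mul (x y : O) :
  oct_norm (oct_mul x y) = oct_norm x * oct_norm y.
Proof.
have [s ->] := octv_surj x; have [t ->] := octv_surj y.
rewrite oct_mul_octv !oct_norm_octv !big_ord_recl !big_ord0 /=.
ring.
Qed.

End Coordinates.

(** * The three composition algebras *)

Lemma linear_map0 (R : nzRingType) (U V : lmodType R) (f : U -> V) :
  linear f -> f 0 = 0.
Proof.
by move=> fL; rewrite -(subrr 0) (GRing.zmod_morphism_linear fL) subrr.
Qed.

Lemma linear_mapZ (R : nzRingType) (U V : lmodType R) (f : U -> V) a u :
  linear f -> f (a *: u) = a *: f u.
Proof. by move=> fL; rewrite -[a *: u]addr0 fL linear_map0 ?addr0. Qed.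

Section Algebra.
Variable R : realType.
Local Notation O := 'rV[R]_8.

Lemma oct_mul_linearl (y : O) : linear (@oct_mul R ^~ y).
Proof.
move=> a u v; rewrite /oct_mul scaler_sumr -big_split /=; apply: eq_bigr => i _.
rewrite scaler_sumr -big_split /=; apply: eq_bigr => j _.
by rewrite !mxE scalerA -scalerDl; congr (_ *: _); ring.
Qed.

Lemma oct_mul_linearr (x : O) : linear (oct_mul x).
Proof.
move=> a u v; rewrite /oct_mul scaler_sumr -big_split /=; apply: eq_bigr => i _.
rewrite scaler_sumr -big_split /=; apply: eq_bigr => j _.
by rewrite !mxE scalerA -scalerDl; congr (_ *: _); ring.
Qed.

Lemma oct_conj_linear : linear (@oct_conj R).
Proof. by move=> a u v; apply/rowP => c; rewrite !mxE; case: ifP => _; ring. Qed.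

Lemma oct_tau_linear : linear (@oct_tau R).
Proof.
move=> a u v; rewrite /oct_tau scaler_sumr -big_split /=; apply: eq_bigr => i _.
by rewrite !mxE scalerA -scalerDl.
Qed.

Lemma oct_norm_conj (x : O) : oct_norm (oct_conj x) = oct_norm x.
Proof.
have [s ->] := octv_surj x; rewrite oct_conj_octv !oct_norm_octv.
by rewrite !big_ord_recl !big_ord0 /=; ring.
Qed.

Lemma oct_norm_tau (x : O) : oct_norm (oct_tau x) = oct_norm x.
Proof.
have [s ->] := octv_surj x; rewrite oct_tau_octv !oct_norm_octv.
by rewrite !big_ord_recl !big_ord0 /=; ring.
Qed.

Lemma oct_normE_sum (x : O) : oct_norm x = \sum_i x 0 i ^+ 2.
Proof.
have [s ->] := octv_surj x; rewrite oct_norm_octv.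
by apply: eq_bigr => i _; rewrite mxE.
Qed.

Lemma oct_normZ a (x : O) : oct_norm (a *: x) = a ^+ 2 * oct_norm x.
Proof.
rewrite !oct_normE_sum mulr_sumr; apply: eq_bigr => i _.
by rewrite mxE exprMn.
Qed.

Lemma oct_polar_sum (x y : O) :
  polar (@oct_norm R) x y = 2 * \sum_i x 0 i * y 0 i.
Proof.
rewrite /polar !oct_normE_sum mulr_sumr -!sumrB; apply: eq_bigr => i _.
by rewrite mxE; ring.
Qed.

Lemma oct_norm_ge0 (x : O) : 0 <= oct_norm x.
Proof. by rewrite oct_normE_sum sumr_ge0 // => i _; exact: sqr_ge0. Qed.

Lemma oct_norm_eq0 (x : O) : oct_norm x = 0 -> x = 0.
Proof.
rewrite oct_normE_sum => /eqP; rewrite psumr_eq0 => [/allP E|i _]; last exact: sqr_ge0.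
apply/rowP => i; rewrite mxE; apply/eqP; rewrite -sqrf_eq0.
by apply: E; rewrite mem_index_enum.
Qed.

Lemma oct_composition p : composition_algebra (product_of p) (@oct_norm R).
Proof.
split.
- by case: p; split=> x a u v /=; rewrite /para_mul /okubo_mul
     ?(oct_conj_linear, oct_tau_linear, oct_mul_linearl, oct_mul_linearr).
- exact: oct_normZ.
- move=> x a u v; rewrite !oct_polar_sum /=.
  rewrite !mulr_sumr -big_split /=.
  by apply: eq_bigr => i _; rewrite !mxE; ring.
- move=> x /(_ x); rewrite oct_polar_sum => /eqP.
  rewrite mulf_eq0 pnatr_eq0 /= => /eqP xx0; apply: oct_norm_eq0.
  by rewrite oct_normE_sum -[RHS]xx0; apply: eq_bigr => i _; rewrite expr2.
- by case: p => x y /=; rewrite /para_mul /okubo_mul oct_norm_mul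
     ?(oct_norm_tau, oct_norm_conj).
Qed.

End Algebra.

(** * The Coxeter-Dickson lattice *)

Section Span.
Variables (R : realType) (A : vectType R) (m : nat) (b : 'I_m -> A).

Lemma ZcombB c d : Zcomb b (c - d) = Zcomb b c - Zcomb b d.
Proof. by rewrite /Zcomb -sumrB; apply: eq_bigr => i _; rewrite !ffunE mulrzBr. Qed.

Lemma Zspan0 : Zspan b 0.
Proof. by exists 0 => //; apply: big1 => i _; rewrite ffunE mulr0z. Qed.

Lemma ZspanB x y : Zspan b x -> Zspan b y -> Zspan b (x - y).
Proof. by move=> [c _ <-] [d _ <-]; exists (c - d) => //; rewrite ZcombB. Qed.

Lemma ZspanD x y : Zspan b x -> Zspan b y -> Zspan b (x + y).
Proof.
move=> bx b_y; rewrite -[y]opprK; apply: ZspanB => //.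
by rewrite -sub0r; apply: ZspanB => //; exact: Zspan0.
Qed.

(** The span is the least subgroup containing the basis; a property of all its
    elements is established by checking that it defines such a subgroup. *)
Lemma Zspan_min (P : set A) :
  P 0 -> (forall x y, P x -> P y -> P (x - y)) -> (forall i, P (b i)) ->
  Zspan b `<=` P.
Proof.
move=> P0 PB Pb _ [c _ <-].
have PN x : P x -> P (- x) by rewrite -sub0r; exact: PB.
have PD x y : P x -> P y -> P (x + y).
  by move=> Px /PN Py; rewrite -[y]opprK; exact: PB.
rewrite /Zcomb; elim/big_ind: _ => // i _.
have Pn n : P (b i *+ n) by elim: n => [|n IH] //; rewrite mulrS; exact: PD.
by case: (c i) => n; [exact: Pn | apply/PN/Pn].
Qed.

End Span.

(** The doubled coordinates of lattice elements: integer words of length eight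
    whose reduction mod 2 lies in the extended Hamming code, here given by parity
    checks in systematic form. *)
Definition parity_word (v : seq int) : bool :=
  [&& size v == 8, (2 %| v`_0 + v`_5 + v`_6 + v`_7)%Z,
      (2 %| v`_1 + v`_4 + v`_6 + v`_7)%Z, (2 %| v`_2 + v`_4 + v`_5 + v`_7)%Z
    & (2 %| v`_3 + v`_4 + v`_5 + v`_6)%Z].

(** The doubled coordinates of the basis 1, i, j, k, h, ih, jh, kh. *)
Definition basis_words : seq (seq int) :=
  [:: [:: 2; 0; 0; 0; 0; 0; 0; 0]; [:: 0; 2; 0; 0; 0; 0; 0; 0];
      [:: 0; 0; 2; 0; 0; 0; 0; 0]; [:: 0; 0; 0; 2; 0; 0; 0; 0];
      [:: 0; 1; 1; 1; 1; 0; 0; 0]; [:: -1; 0; -1; 1; 0; 1; 0; 0];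
      [:: -1; 1; 0; -1; 0; 0; 1; 0]; [:: -1; -1; 1; 0; 0; 0; 0; 1]].

(** The doubled coordinates of the combination of the basis with coefficients
    [c]. *)
Definition comb_word (c : nat -> int) : seq int :=
  [:: 2 * c 0%N - c 5%N - c 6%N - c 7%N; 2 * c 1%N + c 4%N + c 6%N - c 7%N;
      2 * c 2%N + c 4%N - c 5%N + c 7%N; 2 * c 3%N + c 4%N + c 5%N - c 6%N;
      c 4%N; c 5%N; c 6%N; c 7%N].

Definition ints_sqr_le (s : nat) : seq int :=
  [seq a <- [seq b%:Z - s%:Z | b <- iota 0 s.*2.+1] | (`|a| ^ 2 <= s)%N].

Lemma mem_ints_sqr_le s a : (a \in ints_sqr_le s) = (`|a| ^ 2 <= s)%N.
Proof.
rewrite mem_filter andb_idr // => le_as; apply/mapP; exists `|(a + s%:Z)%R|%N.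
  by rewrite mem_iota; nia.
nia.
Qed.

(** The first entry determines how much squared length is left for the others,
    so the enumeration never visits the whole box of small words. *)
Fixpoint sphere (n s : nat) : seq (seq int) :=
  if n is m.+1 then
    [seq a :: v | a <- ints_sqr_le s, v <- sphere m (s - `|a| ^ 2)]
  else if s == 0%N then [:: [::]] else [::].

Lemma mem_sphere n s v :
  (v \in sphere n s) = (size v == n) && (\sum_(a <- v) `|a| ^ 2 == s)%N.
Proof.
elim: n s v => [|n IH] s v /=.
  case: v => [|a v]; rewrite ?big_nil ?eqxx /= eq_sym; case: eqP => //.
apply/allpairsPdep/idP => [[a [w [+ + ->]]]|].
  rewrite mem_ints_sqr_le IH big_cons => le_as /andP[/eqP <- /eqP ->] /=.
  by rewrite subnKC // !eqxx.
case: v => [|a v] //=; rewrite eqSS big_cons => /andP[sv /eqP sa].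
exists a, v; split=> //; last by rewrite IH sv -sa addKn /=.
by rewrite mem_ints_sqr_le -sa leq_addr.
Qed.

(** Existential, so that the explicit list, which is large, never gets unfolded
    where only these three properties of it matter. *)
Lemma root_words : exists ws : seq (seq int),
  [/\ uniq ws, size ws = 240%N & forall v, v \in ws =
    [&& parity_word v, size v == 8 & (\sum_(a <- v) `|a| ^ 2 == 4)%N]].
Proof.
exists [seq v <- sphere 8 4 | parity_word v]; split; try by vm_compute.
by move=> v; rewrite mem_filter mem_sphere.
Qed.

Section Lattice.
Variable R : realType.
Local Notation O := 'rV[R]_8.
Local Notation half_octv v := (2^-1 *: octv (map (intr : int -> R) v)).

Lemma half_octvE (v : seq int) i : (half_octv v) 0 i = 2^-1 * (v`_i)%:~R.
Proof. by rewrite !mxE nth_map_rmorph. Qed.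

Lemma oct_hE : oct_h R = half_octv [:: 0; 1; 1; 1; 1; 0; 0; 0].
Proof.
apply/rowP => i; rewrite half_octvE !mxE; move: (nat_of_ord i) (ltn_ord i) => {}i.
by do 8 (case: i => [_|i] /=; first by ring).
Qed.

Lemma oct_unit_half a :
  oct_unit R a = half_octv (mkseq (fun i => (i == a)%:Z *+ 2) 8).
Proof.
apply/rowP => j; rewrite half_octvE nth_mkseq // mxE.
by case: (_ == a); rewrite /= ?mulr0 //; field.
Qed.

Lemma coxeter_dickson_basisE i :
  coxeter_dickson_basis R i = half_octv (nth [::] basis_words i).
Proof.
rewrite /coxeter_dickson_basis.
have unit_h a : oct_mul (oct_unit R a) (oct_h R) = half_octv
    (mul_seq (mkseq (fun i => (i == a)%:Z) 8) [:: 0; 1; 1; 1; 1; 0; 0; 0]).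
  rewrite oct_hE oct_unitE map_mul_seq -oct_mul_octv.
  rewrite (linear_mapZ _ _ (oct_mul_linearr _)).
  by congr (_ *: oct_mul (octv _) _).
move: (nat_of_ord i) (ltn_ord i) => {}i.
by do 8 (case: i => [_|i] /=; first by rewrite ?unit_h ?oct_unit_half ?oct_hE).
Qed.

Lemma Zcomb_half_octv c :
  Zcomb (coxeter_dickson_basis R) c = half_octv (comb_word (fun k => c (inord k))).
Proof.
apply/rowP => i; rewrite half_octvE /Zcomb summxE.
transitivity (\sum_(j < 8) 2^-1 * ((nth [::] basis_words j)`_i * c (inord j))%:~R : R).
  apply: eq_bigr => j _; rewrite -scaler_int coxeter_dickson_basisE mxE half_octvE.
  by rewrite inord_val rmorphM /=; ring.
rewrite -mulr_sumr -rmorph_sum !big_ord_recl big_ord0 /=; congr (_ * _%:~R).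
move: (nat_of_ord i) (ltn_ord i) => {}i; rewrite /bump /=.
by do 8 (case: i => [_|i] /=; first by ring).
Qed.

(** Solving for the coefficients in the basis: the last four are the last four
    entries of the word, and the parity conditions say that the first four are
    integers. *)
Lemma coxeter_dicksonP (x : O) :
  coxeter_dickson x <-> exists2 v, parity_word v & x = half_octv v.
Proof.
split=> [[c _ <-]|[v]].
  exists (comb_word (fun k => c (inord k))); last exact: Zcomb_half_octv.
  by rewrite /parity_word /=; lia.
case: v => [|v0 [|v1 [|v2 [|v3 [|v4 [|v5 [|v6 [|v7 []]]]]]]]] //.
rewrite /parity_word /= => /and4P[d0 d1 d2 d3] ->.
pose c := [:: ((v0 + v5 + v6 + v7) %/ 2)%Z; ((v1 - v4 - v6 + v7) %/ 2)%Z;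
  ((v2 - v4 + v5 - v7) %/ 2)%Z; ((v3 - v4 - v5 + v6) %/ 2)%Z; v4; v5; v6; v7].
exists [ffun i : 'I_8 => c`_i] => //; rewrite Zcomb_half_octv /comb_word.
rewrite !ffunE !inordK // /c /=.
by congr (_ *: octv (map _ [:: _; _; _; _; _; _; _; _])); lia.
Qed.

Lemma half_octv_inj v w : size v = 8%N -> size w = 8%N ->
  half_octv v = half_octv w -> v = w.
Proof.
move=> sv sw E; apply: (@eq_from_nth _ 0); rewrite ?sv ?sw // => i i8.
have /rowP/(_ (Ordinal i8)) := E; rewrite !half_octvE /= => /mulfI.
by rewrite invr_eq0 pnatr_eq0 => /(_ isT) /intr_inj.
Qed.

Lemma coxeter_dickson_basis_inj : injective (Zcomb (coxeter_dickson_basis R)).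
Proof.
move=> c d; rewrite !Zcomb_half_octv => /half_octv_inj -/(_ erefl erefl) cd.
have E k := congr1 (nth 0 ^~ k) cd; apply/ffunP => i; rewrite -[i]inord_val.
move: (E 0) (E 1) (E 2) (E 3) (E 4) (E 5) (E 6) (E 7) => /= {cd E}.
move: (nat_of_ord i) (ltn_ord i) => {}i.
by do 8 (case: i => [_|i]; first by lia).
Qed.

(** By biadditivity only products of basis elements matter. Multiplying doubled
    words gives four times the product, so half of the result has to be
    a parity word; this is an evaluation over the integers. *)
Lemma coxeter_dickson_mul (x y : O) :
  coxeter_dickson x -> coxeter_dickson y -> coxeter_dickson (oct_mul x y).
Proof.
have basis_mul v w : v \in basis_words -> w \in basis_words ->
    coxeter_dickson (oct_mul (half_octv v) (half_octv w)).
  move=> vb wb; apply/coxeter_dicksonP.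
  exists [seq (a %/ 2)%Z | a <- mul_seq v w].
    have /allP/(_ v vb)/allP/(_ w wb) // : all (fun v => all (fun w =>
      parity_word [seq (a %/ 2)%Z | a <- mul_seq v w]) basis_words) basis_words.
    by vm_compute.
  have /allP/(_ v vb)/allP/(_ w wb)/allP even : all (fun v => all (fun w =>
      all (fun a => (a == (a %/ 2)%Z * 2)) (mul_seq v w)) basis_words) basis_words.
    by vm_compute.
  rewrite (linear_mapZ _ _ (oct_mul_linearl _)) (linear_mapZ _ _ (oct_mul_linearr _)).
  rewrite oct_mul_octv -map_mul_seq !octvZ -!map_comp; congr octv.
  apply/eq_in_map => a /even /eqP {1}-> /=.
  by rewrite rmorphM /=; field.
move=> Lx.
apply: (@Zspan_min _ _ _ _ [set u | coxeter_dickson (oct_mul x u)]) => [|u v|] /=.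
- by rewrite (linear_map0 (oct_mul_linearr _)); exact: Zspan0.
- by rewrite (GRing.zmod_morphism_linear (oct_mul_linearr _)); exact: ZspanB.
move=> j; apply: (@Zspan_min _ _ _ _ [set u | coxeter_dickson (oct_mul u _)] _ _ _ _ Lx)
  => [|u v|i] /=.
- by rewrite (linear_map0 (oct_mul_linearl _)); exact: Zspan0.
- rewrite (GRing.zmod_morphism_linear (oct_mul_linearl _)); exact: ZspanB.
by rewrite !coxeter_dickson_basisE; apply: basis_mul; exact: mem_nth.
Qed.

Lemma coxeter_dickson_conj (x : O) :
  coxeter_dickson x -> coxeter_dickson (oct_conj x).
Proof.
move=> /coxeter_dicksonP[v vP ->]; apply/coxeter_dicksonP; exists (conj_seq v).
  case: v vP => [|v0 [|v1 [|v2 [|v3 [|v4 [|v5 [|v6 [|v7 []]]]]]]]] //.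
  by rewrite /parity_word /=; lia.
rewrite (linear_mapZ _ _ (@oct_conj_linear _)) oct_conj_octv.
by rewrite /conj_seq /= !nth_map_rmorph !rmorphN.
Qed.

Lemma coxeter_dickson_tau (x : O) :
  coxeter_dickson x -> coxeter_dickson (oct_tau x).
Proof.
move=> /coxeter_dicksonP[v vP ->]; apply/coxeter_dicksonP; exists (tau_seq v).
  case: v vP => [|v0 [|v1 [|v2 [|v3 [|v4 [|v5 [|v6 [|v7 []]]]]]]]] //.
  by rewrite /parity_word /=; lia.
rewrite (linear_mapZ _ _ (@oct_tau_linear _)) oct_tau_octv.
by rewrite /tau_seq /= !nth_map_rmorph !rmorphN.
Qed.

Lemma coxeter_dickson_unit a : (a < 8)%N -> coxeter_dickson (oct_unit R a).
Proof.
move=> a8; apply/coxeter_dicksonP; exists (mkseq (fun i => (i == a)%:Z *+ 2) 8).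
  by move: a a8; do 8 case=> //.
exact: oct_unit_half.
Qed.

Lemma oct_norm_half_octv (v : seq int) : size v = 8%N ->
  oct_norm (half_octv v) = (\sum_(a <- v) a ^+ 2)%:~R / 4.
Proof.
move=> sv; rewrite oct_normE_sum [in RHS](big_nth 0) sv big_mkord rmorph_sum mulr_suml.
by apply: eq_bigr => i _; rewrite half_octvE rmorphXn /=; field.
Qed.

(** Write each of the first four entries of a parity word as an even number minus
    the sum of three of the others. In the squared length, the square of each of
    the last four entries and the product of any two of them then have
    coefficient 4. *)
Lemma coxeter_dickson_norm_int (x : O) :
  coxeter_dickson x -> oct_norm x \is a Num.int.
Proof.
move=> /coxeter_dicksonP[v vP ->].
have sv : size v = 8%N by case/andP: vP => /eqP.
rewrite oct_norm_half_octv //.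
suff [k ->] : exists k : int, \sum_(a <- v) a ^+ 2 = k * 4.
  by rewrite rmorphM mulfK ?pnatr_eq0 // intr_int.
move: v vP {sv} => [|v0 [|v1 [|v2 [|v3 [|v4 [|v5 [|v6 [|v7 []]]]]]]]] //.
rewrite /parity_word /= => /and4P[/dvdzP[a Ea] /dvdzP[b Eb] /dvdzP[c Ec] /dvdzP[d Ed]].
have {Ea}-> : v0 = a * 2 - (v5 + v6 + v7) by lia.
have {Eb}-> : v1 = b * 2 - (v4 + v6 + v7) by lia.
have {Ec}-> : v2 = c * 2 - (v4 + v5 + v7) by lia.
have {Ed}-> : v3 = d * 2 - (v4 + v5 + v6) by lia.
exists (a ^+ 2 + b ^+ 2 + c ^+ 2 + d ^+ 2 - a * (v5 + v6 + v7) - b * (v4 + v6 + v7)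
  - c * (v4 + v5 + v7) - d * (v4 + v5 + v6) + v4 ^+ 2 + v5 ^+ 2 + v6 ^+ 2 + v7 ^+ 2
  + v4 * v5 + v4 * v6 + v4 * v7 + v5 * v6 + v5 * v7 + v6 * v7).
by rewrite !big_cons big_nil; ring.
Qed.

Lemma coxeter_dickson_trace_int (x : O) :
  coxeter_dickson x -> polar (@oct_norm R) x (oct_unit R 0) \is a Num.int.
Proof.
move=> /coxeter_dicksonP[v vP ->]; rewrite oct_polar_sum (bigD1 ord0) //= big1.
  by rewrite half_octvE mxE addr0 mulr1 mulVKf ?pnatr_eq0 // intr_int.
by move=> i; rewrite -val_eqE !mxE => /negPf ->; rewrite mulr0.
Qed.

Lemma E8_integral_system p : integral_system (E8_system R p) (oct_unit R 0).
Proof.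
split=> /=.
- by split; [exact: oct_composition | rewrite dimvf /dim /= mul1n].
- split.
    by apply/eqP => /rowP/(_ ord0); rewrite !mxE => /eqP; rewrite oner_eq0.
  case: p => /=; rewrite /para_mul /okubo_mul oct_unitE ?oct_conj_octv
    ?oct_tau_octv ?oct_mul_octv; apply: octvP;
    by do 8 (case=> [_|]; first by rewrite /=; ring).
- by exists (coxeter_dickson_basis R); split=> //; exact: coxeter_dickson_basis_inj.
- split; first exact: coxeter_dickson_unit.
  by case: p => x y Lx Ly /=; do ?[apply: coxeter_dickson_mul|
    apply: coxeter_dickson_conj|apply: coxeter_dickson_tau].
- by move=> x Lx; split; [exact: coxeter_dickson_norm_int |
    exact: coxeter_dickson_trace_int].
Qed.

Lemma half_octv_norm1 v : size v = 8%N ->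
  oct_norm (half_octv v) = 1 <-> (\sum_(a <- v) `|a| ^ 2 = 4)%N.
Proof.
move=> sv; rewrite oct_norm_half_octv //.
have -> : \sum_(a <- v) a ^+ 2 = (\sum_(a <- v) `|a| ^ 2)%N%:Z.
  rewrite (big_morph Posz PoszD erefl).
  by apply: eq_bigr => a _; rewrite -abszX abszE ger0_norm ?sqr_ge0.
have n4 : 4 != 0 :> R by rewrite pnatr_eq0.
split=> [/(canRL (divfK n4))|->]; last by rewrite divff.
by rewrite mul1r => /eqP; rewrite eqr_nat => /eqP.
Qed.

Lemma card_norm_one_vectors p : norm_one_vectors (E8_system R p) #= `I_240.
Proof.
have [ws [ws_uniq ws_size ws_mem]] := root_words.
have -> : norm_one_vectors (E8_system R p) =
    (fun v => half_octv v) @` [set` [fset v in ws]%fset].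
  apply/seteqP; split=> [x [/coxeter_dicksonP[v vP ->] /= n1]|_ [v + <-]].
    have sv : size v = 8%N by case/andP: vP => /eqP.
    exists v => //=; rewrite !inE ws_mem vP sv eqxx /=.
    by apply/eqP/half_octv_norm1.
  rewrite /= !inE ws_mem => /and3P[vP /eqP sv /eqP n1]; split.
    by apply/coxeter_dicksonP; exists v.
  exact/half_octv_norm1.
apply: (@card_eq_trans _ _ _ _ [set` [fset v in ws]%fset]).
  apply: inj_card_eq => v w; rewrite 2!in_setE /= !inE !ws_mem.
  by move=> /and3P[_ /eqP sv _] /and3P[_ /eqP sw _]; exact: half_octv_inj.
by apply/card_eq_fsetP; rewrite card_fseq undup_id.
Qed.

End Lattice.

(** * Vertices of the Gosset polytope *)

Section Vertices.
Variables (R : realType) (A : vectType R).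

Lemma convex_setP (P : set A) : @convex_set R A P <->
  (forall x y (t : R), P x -> P y -> 0 < t < 1 -> P (t *: x + (1 - t) *: y)).
Proof.
split=> [cP x y t Px Py t01|cP].
  have /andP[t0 t1] : 0 <= t <= 1 by case/andP: t01 => /ltW -> /ltW ->.
  exact: set_mem (cP x y (Itv01 t0 t1) (mem_set Px) (mem_set Py)).
apply/convex_setW => x y /set_mem Px /set_mem Py k k0 k1; apply: mem_set.
by apply: cP; rewrite ?k0.
Qed.

(** If an extreme point [x] of the hull were not in [X], the hull without [x]
    would still be convex and contain [X]. *)
Lemma vertices_hull_sub (X : set A) : vertices (convex_hull X) `<=` X.
Proof.
move=> x [Px xext]; apply: contrapT => nXx.
suff [_ /(_ erefl)] : (convex_hull X `\` [set x]) x by [].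
apply: (Px); split=> [|y Xy]; last first.
  by split=> [|yx]; [exact: sub_gen_smallest | apply: nXx; rewrite -yx].
apply/convex_setP => y z t [Py nyx] [Pz nzx] t01; split.
  by move=> C [cC XC]; move/convex_setP: (cC); apply=> //; [apply: Py|apply: Pz].
by move=> E; apply: nyx; have [] := xext _ _ _ Py Pz t01 (esym E).
Qed.

End Vertices.

Section Sphere.
Variable R : realType.
Local Notation O := 'rV[R]_8.

(** Stewart's identity; the last term measures the strict convexity of balls. *)
Lemma oct_norm_conv (x y : O) t : oct_norm (t *: x + (1 - t) *: y) =
  t * oct_norm x + (1 - t) * oct_norm y - t * (1 - t) * oct_norm (x - y).
Proof.
rewrite !oct_normE_sum !mulr_sumr -big_split -sumrB /=; apply: eq_bigr => i _.
by rewrite !mxE; ring.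
Qed.

(** The hull lies in the unit ball. If a point of the sphere is properly between
    [y] and [z] in the ball, the last term of [oct_norm_conv] must vanish, so
    [y = z]. *)
Lemma sphere_sub_vertices (X : set O) :
  (forall x, X x -> oct_norm x = 1) -> X `<=` vertices (convex_hull X).
Proof.
move=> X1 x Xx; split; first exact: sub_gen_smallest.
have avg_le1 (a b t : R) : a <= 1 -> b <= 1 -> 0 < t -> t < 1 ->
    t * a + (1 - t) * b <= 1.
  move=> a1 b1 t0 t1; rewrite -[leRHS](subrK t) addrC -[X in _ <= X + _]mulr1.
  by rewrite -[X in _ <= _ + X]mulr1 lerD // ler_pM2l // subr_gt0.
have gap_ge0 y z (t : R) : 0 < t -> t < 1 -> 0 <= t * (1 - t) * oct_norm (y - z).
  by move=> t0 t1; rewrite !mulr_ge0 ?oct_norm_ge0 // ?subr_ge0 ltW.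
have ball : convex_hull X `<=` [set y | oct_norm y <= 1].
  apply: smallest_sub => [|y /X1 /= -> //].
  apply/convex_setP => y z t /= y1 z1 /andP[t0 t1].
  rewrite oct_norm_conv lerBlDr (le_trans (avg_le1 _ _ _ y1 z1 t0 t1)) //.
  by rewrite lerDl gap_ge0.
move=> y z t /ball /= y1 /ball /= z1 /andP[t0 t1] xE.
have yz : y = z.
  apply/eqP; rewrite -subr_eq0; apply/eqP/oct_norm_eq0/eqP.
  have /eqP : t * (1 - t) * oct_norm (y - z) = 0.
    apply/eqP; rewrite eq_le gap_ge0 // andbT.
    have := avg_le1 _ _ _ y1 z1 t0 t1; rewrite -[leRHS](X1 x Xx) xE oct_norm_conv.
    by rewrite lerBrDr gerDl.
  by rewrite !mulf_eq0 subr_eq0 gt_eqF // gt_eqF.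
by rewrite xE yz -scalerDl addrC subrK scale1r.
Qed.

End Sphere.

(** * Non-isomorphism *)

Section Invariants.
Variables (R : realType) (A : vectType R).

Definition has_left_unit (S : system A) :=
  exists2 e, lattice S e & forall x, lattice S x -> product S e x = x.

(** Only commutation is asked for: the products need not be associative. *)
Definition has_nonzero_center (S : system A) :=
  exists e, [/\ lattice S e, e != 0 &
    forall x, lattice S x -> product S e x = product S x e].

End Invariants.

(** The map respects the operations only on the lattice, hence the two closure
    hypotheses. *)
Lemma algebra_isomorphic_sym (R : realType) (A B : vectType R)
    (S : system A) (T : system B) :
  (forall x y, lattice S x -> lattice S y -> lattice S (x + y)) ->
  (forall x y, lattice S x -> lattice S y -> lattice S (product S x y)) ->
  algebra_isomorphic S T -> algebra_isomorphic T S.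
Proof.
move=> SD SM [f [[[fST finj fsurj] fD] fM]].
have [g gP] : exists g, forall y, lattice T y -> lattice S (g y) /\ f (g y) = y.
  have /choice[g gP] : forall y, exists x, lattice T y -> lattice S x /\ f x = y.
    move=> y; have [/fsurj[x Sx <-]|nTy] := pselect (lattice T y); first by exists x.
    by exists 0.
  by exists g.
have gf x : lattice S x -> g (f x) = x.
  move=> Sx; have Tfx : lattice T (f x) by exact: fST.
  by have [Sg fg] := gP _ Tfx; apply: finj => //; exact: mem_set.
exists g; split; [split|].
- split.
  + by move=> y /gP[].
  + by move=> x y /set_mem/gP[_ fx] /set_mem/gP[_ fy] E; rewrite -fx -fy E.
  + move=> x Sx; exists (f x); last exact: gf.
    exact: fST.
- move=> x y /gP[Sx fx] /gP[Sy fy]; rewrite -[in LHS]fx -[in LHS]fy -fD // gf //.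
  exact: SD.
- move=> x y /gP[Sx fx] /gP[Sy fy]; rewrite -[in LHS]fx -[in LHS]fy -fM // gf //.
  exact: SM.
Qed.

Lemma has_left_unit_iso (R : realType) (A B : vectType R)
    (S : system A) (T : system B) :
  algebra_isomorphic S T -> has_left_unit S -> has_left_unit T.
Proof.
move=> [f [[[fST _ fsurj] _] fM]] [e Se eS]; exists (f e).
  exact: fST.
by move=> _ /fsurj[x Sx <-]; rewrite -fM // eS.
Qed.

Lemma has_nonzero_center_iso (R : realType) (A B : vectType R)
    (S : system A) (T : system B) :
  lattice S 0 -> algebra_isomorphic S T ->
  has_nonzero_center S -> has_nonzero_center T.
Proof.
move=> S0 [f [[[fST finj fsurj] fD] fM]] [e [Se e0 eS]]; exists (f e); split.
- exact: fST.
- have f0 : f 0 = 0 by apply: (addrI (f 0)); rewrite addr0 -fD // addr0.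
  by apply: contra_neq e0 => fe0; apply: finj; rewrite ?fe0 ?f0 //; exact: mem_set.
by move=> _ /fsurj[x Sx <-]; rewrite -!fM // eS.
Qed.

Section NonIsomorphism.
Variable R : realType.
Local Notation S p := (E8_system R p).

Lemma oct_left_unit : has_left_unit (S Octonionic).
Proof.
exists (oct_unit R 0); first exact: coxeter_dickson_unit.
move=> x _ /=; have [s ->] := octv_surj x; rewrite oct_unitE oct_mul_octv.
by apply: octvP; do 8 (case=> [_|]; first by rewrite /=; ring).
Qed.

(** Applied to 1, a left unit [e] gives [conj e = 1]; then it sends i to [- i]. *)
Lemma para_no_left_unit : ~ has_left_unit (S ParaOctonionic).
Proof.
case=> e _ eS.
have /eS /= := @coxeter_dickson_unit R 0 isT.
have /eS /= := @coxeter_dickson_unit R 1 isT.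
rewrite /para_mul; have [s ->] := octv_surj e.
rewrite !oct_unitE !oct_conj_octv !oct_mul_octv.
move=> /(octv_inj (i := 1)) -/(_ isT) /= i1 /(octv_inj (i := 0)) -/(_ isT) /= i0.
lra.
Qed.

Lemma oct_nonzero_center : has_nonzero_center (S Octonionic).
Proof.
exists (oct_unit R 0); split; first exact: coxeter_dickson_unit.
  by apply/eqP => /rowP/(_ ord0); rewrite !mxE => /eqP; rewrite oner_eq0.
move=> x _ /=; have [s ->] := octv_surj x; rewrite oct_unitE !oct_mul_octv.
by apply: octvP; do 8 (case=> [_|]; first by rewrite /=; ring).
Qed.

Lemma para_nonzero_center : has_nonzero_center (S ParaOctonionic).
Proof.
exists (oct_unit R 0); split; first exact: coxeter_dickson_unit.
  by apply/eqP => /rowP/(_ ord0); rewrite !mxE => /eqP; rewrite oner_eq0.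
move=> x _ /=; rewrite /para_mul; have [s ->] := octv_surj x.
rewrite oct_unitE !oct_conj_octv !oct_mul_octv.
by apply: octvP; do 8 (case=> [_|]; first by rewrite /=; ring).
Qed.

(** Commuting with i and l suffices. Let [f = tau (conj e)]. Since tau fixes l,
    commutation with l reads [f l = l (tau f)]. The part of [f] orthogonal to 1
    and l anticommutes with l, so tau negates it; as tau has order three, this
    part vanishes. Hence [e] is in the plane of 1 and l, and commutation with i
    equates [(conj e) k] with [- j (conj e)]. The former is in the plane of k and
    kl, the latter in that of j and jl, so both vanish. *)
Lemma okubo_no_nonzero_center : ~ has_nonzero_center (S Okubo).
Proof.
case=> e [_ /negP e0 eS]; apply: e0; apply/eqP.
have comm k : (k < 8)%N -> okubo_mul e (oct_unit R k) = okubo_mul (oct_unit R k) e.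
  by move=> k8; apply: eS; exact: coxeter_dickson_unit.
move: (comm 1 isT) (comm 4 isT) => {comm eS}; have [s ->] := octv_surj e.
rewrite /okubo_mul !oct_unitE !(oct_conj_octv, oct_tau_octv) !oct_mul_octv.
move=> /octv_inj Ei /octv_inj El.
move: (Ei 3 isT) (Ei 7 isT) => /= {Ei} i3 i7.
move: (El 1 isT) (El 2 isT) (El 3 isT) => /= l1 l2 l3.
move: (El 5 isT) (El 6 isT) (El 7 isT) => /= {El} l5 l6 l7.
apply/rowP => i; rewrite !mxE; move: (nat_of_ord i) (ltn_ord i) => {}i.
by do 8 (case: i => [_|i]; first by lra).
Qed.

Lemma E8_not_isomorphic p q : p <> q -> ~ algebra_isomorphic (S p) (S q).
Proof.
have SD r x y : lattice (S r) x -> lattice (S r) y -> lattice (S r) (x + y).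
  exact: ZspanD.
have SM r x y : lattice (S r) x -> lattice (S r) y ->
    lattice (S r) (product (S r) x y).
  by case: (E8_integral_system R r) => _ _ _ [_ M] _; exact: M.
have sym r s : algebra_isomorphic (S r) (S s) -> algebra_isomorphic (S s) (S r).
  by apply: algebra_isomorphic_sym; [exact: SD|exact: SM].
have L0 r : lattice (S r) 0 by exact: Zspan0.
have OP : ~ algebra_isomorphic (S Octonionic) (S ParaOctonionic).
  by move=> /has_left_unit_iso/(_ oct_left_unit); exact: para_no_left_unit.
have OK : ~ algebra_isomorphic (S Octonionic) (S Okubo).
  move=> /(has_nonzero_center_iso (L0 _))/(_ oct_nonzero_center).
  exact: okubo_no_nonzero_center.
have PK : ~ algebra_isomorphic (S ParaOctonionic) (S Okubo).
  move=> /(has_nonzero_center_iso (L0 _))/(_ para_nonzero_center).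
  exact: okubo_no_nonzero_center.
by case: p; case: q => // _ /sym.
Qed.

End NonIsomorphism.

Theorem proposition1 (R : realType) :
  (forall p, integral_system (E8_system R p) (oct_unit R 0)) /\
  (forall p q, lattice_isometry (E8_system R p) (E8_system R q) idfun) /\
  (forall p q (b : 'I_8 -> 'rV[R]_8), Zbasis b (@coxeter_dickson R) ->
     gram (E8_system R p) b = gram (E8_system R q) b) /\
  (forall p, norm_one_vectors (E8_system R p) #= `I_240) /\
  (forall p q,
     norm_one_vectors (E8_system R p) = norm_one_vectors (E8_system R q)) /\
  (forall p q,
     gosset_polytope (E8_system R p) = gosset_polytope (E8_system R q)) /\
  (forall p, vertices (gosset_polytope (E8_system R p)) =
     norm_one_vectors (E8_system R p)) /\
  (forall p q, p <> q ->
     ~ algebra_isomorphic (E8_system R p) (E8_system R q)).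
Proof.
split; first exact: E8_integral_system.
split.
  by move=> p q; do 3 split=> //; exists x.
split; first by [].
split; first exact: card_norm_one_vectors.
do 2 (split; first by []).
split; last exact: E8_not_isomorphic.
move=> p; apply/seteqP; split; first exact: vertices_hull_sub.
by apply: sphere_sub_vertices => x [].
Qed.
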